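(* Let $k$ be an $F$-finite field of characteristic $p>0$, let $R=k[x_1,\dots,x_n]/I$ be a quotient of a polynomial ring, let $\mathcal{C}$ be an $R$-Cartier algebra and $M$ a coherent left $\mathcal{C}$-module such that the pair $(M,\mathcal{C})$ is gauge bounded, and let $\mathfrak{a}\subseteq R$ be an ideal. Then the jumping numbers of $\tau(M,\mathcal{C},\mathfrak{a}^t)$ form a discrete subset of $\mathbb{R}_{\ge0}$.
   Context: A field $k$ of characteristic $p$ is $F$-finite if $[k:k^p]<\infty$. $R$-Cartier algebra: an $\mathbb{N}$-graded (generally non-commutative) ring $\mathcal{C}=\bigoplus_{e\ge 0}\mathcal{C}_e$ with a ring homomorphism $R\to\mathcal{C}$ whose image is $\mathcal{C}_0$, such that $r\cdot\phi=\phi\cdot r^{p^e}$ for all $r\in R$, $\phi\in\mathcal{C}_e$. Every left $\mathcal{C}$-module $M$ is an $R$-module via $R\to\mathcal{C}_0$; it is coherent if finitely generated over $R$. Put $\mathcal{C}_+=\bigoplus_{e\ge1}\mathcal{C}_e$ and let $\mathcal{C}_+^nM$ be the $\mathcal{C}$-submodule of $M$ generated by all $\phi_1\cdots\phi_n m$ with $\phi_i\in\mathcal{C}_+$, $m\in M$. $M$ is $F$-pure if $\mathcal{C}_+M=M$. For coherent $M$ the chain $M\supseteq\mathcal{C}_+M\supseteq\mathcal{C}_+^2M\supseteq\cdots$ stabilizes, and its stable member $\underline{M}_{\mathcal{C}}$ is the largest $F$-pure $\mathcal{C}$-submodule of $M$. Test module: $\tau(M,\mathcal{C})$ is the smallest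 $\mathcal{C}$-submodule $N\subseteq M$ such that $N_\eta=(\underline{M}_{\mathcal{C}})_\eta$ for each generic point $\eta$ of an irreducible component of $\operatorname{Supp}\underline{M}_{\mathcal{C}}$; in the present setting ($R$ of finite type over an $F$-finite field) it always exists. For an ideal $\mathfrak{a}$ and real $t\ge0$, $\mathcal{C}^{\mathfrak{a}^t}\subseteq\mathcal{C}$ is the $R$-Cartier algebra with $(\mathcal{C}^{\mathfrak{a}^t})_e=\mathcal{C}_e\cdot\mathfrak{a}^{\lceil t(p^e-1)\rceil}$, and $\tau(M,\mathcal{C},\mathfrak{a}^t):=\tau(M,\mathcal{C}^{\mathfrak{a}^t})$. These modules decrease as $t$ increases. A real number $t>0$ is a jumping number if $\tau(M,\mathcal{C},\mathfrak{a}^{t-\epsilon})\supsetneq\tau(M,\mathcal{C},\mathfrak{a}^t)$ for all $0<\epsilon\le t$. Gauges: let $S=k[x_1,\dots,x_n]$ and, for $d\ge0$, let $S_d$ be the $k$-span of the monomials $x_1^{i_1}\cdots x_n^{i_n}$ with $\max_j i_j\le d$. Given $R$-module generators $m_1,\dots,m_l$ of $M$, put $M_{-\infty}=0$ and $M_d=S_dm_1+\dots+S_dm_l$ for $d\ge 0$. The associated gauge $\delta:M\to\{-\infty\}\cup\mathbb{N}$ sends $m$ to the least $d\in\{-\infty\}\cup\mathbb{N}$ with $m\in M_d$. The pair $(M,\mathcal{C})$ is gauge bounded if for some (equivalently each) gauge $\delta$ on $M$ there exist a set $\{\psi_i\in\mathcal{C}_{e_i}, e_i\ge1\}_{i\in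 J}$ generating $\mathcal{C}_+$ as a right $R$-module and a constant $K$ such that $\delta(\psi_i(m))\le\frac{\delta(m)}{p^{e_i}}+\frac{K}{p-1}$ for all $i\in J$ and $m\in M$. *)

(* Defs.v *)
From HB Require Import structures.
From mathcomp Require Import all_boot all_order all_algebra.
From mathcomp Require Import boolp classical_sets reals ereal topology normedtype.
(* The notations of mpoly clash with those of MathComp-Analysis. *)
From mathcomp Require Import -(notations) mpoly.

Set Implicit Arguments.
Unset Strict Implicit.
Unset Printing Implicit Defensive.
Import Order.TTheory GRing.Theory Num.Theory.
Import numFieldNormedType.Exports.
Local Open Scope classical_set_scope.
Local Open Scope ring_scope.

Definition Ffinite (p : nat) (k : fieldType) : Prop :=
  exists (N : nat) (b : 'I_N -> k), forall x : k,
    exists a : 'I_N -> k, x = \sum_(i < N) a i ^+ p * b i.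

Section CommutativeAlgebra.
Variable R : comPzRingType.

Definition is_ideal (I : set R) : Prop :=
  [/\ I 0, forall x y, I x -> I y -> I (x + y) & forall r x, I x -> I (r * x)].

Definition ideal_power (I : set R) (m : nat) : set R :=
  [set x | exists (N : nat) (r : 'I_N -> R) (y : 'I_N -> 'I_m -> R),
    (forall j i, I (y j i)) /\ x = \sum_(j < N) r j * \prod_(i < m) y j i].

Definition is_prime (P : set R) : Prop :=
  [/\ is_ideal P, ~ P 1 & forall x y, P (x * y) -> P x \/ P y].

(* Spec R is the set of all P with [is_prime P]; its subsets have type
   [set (set R)]. *)
Definition zariski_closed (Z : set (set R)) : Prop :=
  exists2 J : set R, is_ideal J & Z = [set P | is_prime P /\ J `<=` P].

Definition irreducible (Z : set (set R)) : Prop :=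
  Z !=set0 /\ forall A B, zariski_closed A -> zariski_closed B ->
    Z `<=` A `|` B -> Z `<=` A \/ Z `<=` B.

Definition irreducible_component (X Z : set (set R)) : Prop :=
  [/\ Z `<=` X, irreducible Z &
      forall Z', Z' `<=` X -> irreducible Z' -> Z `<=` Z' -> Z' = Z].

Definition generic_point (Z : set (set R)) (P : set R) : Prop :=
  Z P /\ forall A, zariski_closed A -> A P -> Z `<=` A.

End CommutativeAlgebra.

Section CartierAlgebra.
Variables (p : nat) (R : comPzRingType) (C : pzRingType).
Variable iota : {rmorphism R -> C}.

(* A graded subring of C is given by its homogeneous parts D e, e : nat. *)
Definition graded_total (D : nat -> set C) : set C :=
  [set c | exists (N : nat) (f : nat -> C),
    (forall e, D e (f e)) /\ c = \sum_(0 <= e < N) f e].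

Definition graded_plus (D : nat -> set C) : set C :=
  [set c | exists (N : nat) (f : nat -> C),
    (forall e, D e (f e)) /\ c = \sum_(1 <= e < N) f e].

(* The direct sum of the D e is a subring of C which, with iota, is an
   R-Cartier algebra. *)
Record cartier_subalgebra (D : nat -> set C) : Prop := CartierSubalgebra {
  piece0 : forall e, D e 0;
  pieceB : forall e c d, D e c -> D e d -> D e (c - d);
  pieceM : forall e f c d, D e c -> D f d -> D (e + f)%N (c * d);
  piece_direct : forall (N : nat) (f : nat -> C), (forall e, D e (f e)) ->
    \sum_(0 <= e < N) f e = 0 -> forall e, (e < N)%N -> f e = 0;
  piece_deg0 : D 0%N = range iota;
  piece_frobenius : forall e c r, D e c -> iota r * c = c * iota (r ^+ (p ^ e)) }.

Definition cartier_algebra (D : nat -> set C) : Prop :=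
  cartier_subalgebra D /\ graded_total D = setT.

Definition right_generates (X : set C) (J : Type) (psi : J -> C) : Prop :=
  (forall i, X (psi i)) /\
  forall c, X c -> exists (N : nat) (i : 'I_N -> J) (r : 'I_N -> R),
    c = \sum_(j < N) psi (i j) * iota (r j).

(* D e * a^ceil(t (p^e - 1)); only used for t >= 0, so that the absolute
   value has no effect. *)
Definition twist (RR : realType) (D : nat -> set C) (a : set R) (t : RR) :
    nat -> set C := fun e =>
  [set c | exists (N : nat) (phi : 'I_N -> C) (x : 'I_N -> R),
    (forall j, D e (phi j) /\
       ideal_power a `|Num.ceil (t * ((p ^ e)%:R - 1))|%N (x j)) /\
    c = \sum_(j < N) phi j * iota (x j)].

Section Modules.
Variable M : lmodType C.

Definition rscale (r : R) (m : M) : M := iota r *: m.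

Definition R_generates (l : nat) (g : 'I_l -> M) : Prop :=
  forall m, exists r : 'I_l -> R, m = \sum_(i < l) rscale (r i) (g i).

Definition coherent : Prop := exists (l : nat) (g : 'I_l -> M), R_generates g.

(* The localization of M at the prime P, realized as the set of the
   equivalence classes [frac P m s] of fractions m/s. *)
Definition frac (P : set R) (m : M) (s : R) : set (M * R) :=
  [set x | ~ P x.2 /\
    exists2 u, ~ P u & rscale u (rscale s x.1 - rscale x.2 m) = 0].

(* The image in M_P of the localization at P of the R-submodule N. *)
Definition localize (P : set R) (N : set M) : set (set (M * R)) :=
  [set z | exists m s, [/\ N m, ~ P s & z = frac P m s]].

Definition support (N : set M) : set (set R) :=
  [set P | is_prime P /\ localize P N <> [set frac P 0 1]].

Section Test.
Variable D : nat -> set C.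

Definition is_submodule (N : set M) : Prop :=
  [/\ N 0, forall m m', N m -> N m' -> N (m + m') &
      forall c m, graded_total D c -> N m -> N (c *: m)].

Definition plus_power (n : nat) : set M :=
  smallest is_submodule
    [set x | exists (phi : 'I_n -> C) (m : M),
      (forall i, graded_plus D (phi i)) /\ x = (\prod_(i < n) phi i) *: m].

(* The chain [plus_power n] is decreasing: if it stabilizes, its intersection
   is its stable member. *)
Definition stable_member : set M := \bigcap_(n in setT) plus_power n.

Definition generically_stable (N : set M) : Prop :=
  forall (Z : set (set R)) (eta : set R),
    irreducible_component (support stable_member) Z -> generic_point Z eta ->
    localize eta N = localize eta stable_member.

(* [smallest] is an intersection: it is the smallest such N as soon as one
   exists. *)
Definition test_module : set M :=
  smallest [set N | is_submodule N /\ generically_stable N] set0.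

End Test.

Definition jumping_number (RR : realType) (D : nat -> set C) (a : set R)
    (t : RR) : Prop :=
  0 < t /\ forall eps : RR, 0 < eps <= t ->
    test_module (twist D a t) `<` test_module (twist D a (t - eps)).

Section Gauge.
Variables (k : fieldType) (n : nat) (pi : {rmorphism mpoly n k -> R}).

Definition bounded_monomials (d : nat) : set (mpoly n k) :=
  [set f | forall m : multinom n, m \in msupp f -> forall j, (m j <= d)%N].

(* Elements of {-oo} U nat are represented in [option nat], with None = -oo. *)
Definition gauge_filtration (l : nat) (g : 'I_l -> M) (d : option nat) : set M :=
  if d is Some d then
    [set m | exists s : 'I_l -> mpoly n k,
      (forall i, bounded_monomials d (s i)) /\
      m = \sum_(i < l) rscale (pi (s i)) (g i)]
  else [set 0].

Definition gauge_val (RR : realType) (d : option nat) : \bar RR :=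
  if d is Some d then (d%:R)%:E else -oo%E.

Definition is_gauge (RR : realType) (l : nat) (g : 'I_l -> M)
    (delta : M -> option nat) : Prop :=
  forall m, gauge_filtration g (delta m) m /\
    forall d, gauge_filtration g d m ->
      (gauge_val RR (delta m) <= gauge_val RR d)%E.

Definition gauge_bounded (RR : realType) (D : nat -> set C) : Prop :=
  exists (l : nat) (g : 'I_l -> M) (delta : M -> option nat),
    [/\ R_generates g, is_gauge RR g delta &
    exists (J : Type) (e : J -> nat) (psi : J -> C) (K : RR),
      [/\ forall i, (1 <= e i)%N /\ D (e i) (psi i),
          right_generates (graded_plus D) psi &
          forall i m, (gauge_val RR (delta (psi i *: m)) <=
            gauge_val RR (delta m) * ((p ^ e i)%:R^-1)%:E
            + (K / (p%:R - 1))%:E)%E]].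

End Gauge.
End Modules.
End CartierAlgebra.


Section Twist.
Variables (p : nat) (R : comPzRingType) (C : pzRingType).
Variables (iota : {rmorphism R -> C}) (RR : realType).

Lemma ideal_power_ideal (a : set R) m : is_ideal (ideal_power a m).
Proof.
split.
- exists 0%N, (fun=> 0), (fun _ _ => 0); split; first by case.
  by rewrite big_ord0.
- move=> _ _ [N [r [y [ha ->]]]] [N' [r' [y' [ha' ->]]]].
  exists (N + N')%N,
    (fun j => match split j with inl i => r i | inr i => r' i end),
    (fun j => match split j with inl i => y i | inr i => y' i end); split.
    by move=> j i; case: (split j).
  rewrite big_split_ord /=; congr (_ + _); apply: eq_bigr => i _.
    by rewrite (unsplitK (inl i : 'I_N + 'I_N')%type).
  by rewrite (unsplitK (inr i : 'I_N + 'I_N')%type).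
- move=> s _ [N [r [y [ha ->]]]]; exists N, (fun j => s * r j), y; split=> //.
  by rewrite mulr_sumr; apply: eq_bigr => i _; rewrite mulrA.
Qed.

Lemma ideal_sum (I : set R) N (x : 'I_N -> R) : is_ideal I ->
  (forall i, I (x i)) -> I (\sum_(i < N) x i).
Proof. by case=> I0 ID _ Ix; elim/big_ind: _. Qed.

Lemma ideal_power0 (a : set R) x : ideal_power a 0 x.
Proof.
exists 1%N, (fun=> x), (fun _ _ => 0); split; first by move=> j [].
by rewrite big_ord1 big_ord0 mulr1.
Qed.

Lemma ideal_powerM (a : set R) m m' x y :
  ideal_power a m x -> ideal_power a m' y -> ideal_power a (m + m') (x * y).
Proof.
have hI := ideal_power_ideal a (m + m').
have [_ _ hS] := hI.
move=> [N [r [u [hu ->]]]] [N' [r' [u' [hu' ->]]]].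
rewrite mulr_suml; apply: ideal_sum => // j.
rewrite mulr_sumr; apply: ideal_sum => // j'.
rewrite mulrACA; apply: hS.
exists 1%N, (fun=> 1), (fun _ i => match split i with
  inl i => u j i | inr i => u' j' i end); split.
  by move=> _ i; case: (split i).
rewrite big_ord1 mul1r big_split_ord /=.
congr (_ * _); apply: eq_bigr => i _.
  by rewrite (unsplitK (inl i : 'I_m + 'I_m')%type).
by rewrite (unsplitK (inr i : 'I_m + 'I_m')%type).
Qed.

Lemma ideal_powerX (a : set R) m x q :
  ideal_power a m x -> ideal_power a (q * m) (x ^+ q).
Proof.
move=> hx; elim: q => [|q IHq]; first by rewrite mul0n; exact: ideal_power0.
by rewrite exprS mulSn; exact: ideal_powerM.
Qed.

Lemma ideal_powerS (a : set R) m m' x : is_ideal a -> (m' <= m)%N ->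
  ideal_power a m x -> ideal_power a m' x.
Proof.
move=> ha /subnK <-; elim: (m - m')%N => [//|d IHd] hx; apply: IHd.
move: hx; rewrite addSn => -[N [r [y [hy ->]]]].
exists N, (fun j => r j * y j ord0), (fun j i => y j (lift ord0 i)).
split; first by move=> j i.
by apply: eq_bigr => j _; rewrite big_ord_recl mulrA.
Qed.

Lemma ceil_twist (t : RR) e f : 0 <= t -> (0 < p)%N ->
  (`|Num.ceil (t * ((p ^ (e + f))%:R - 1))|
   <= p ^ f * `|Num.ceil (t * ((p ^ e)%:R - 1))|
      + `|Num.ceil (t * ((p ^ f)%:R - 1))|)%N.
Proof.
move=> t0 p0.
have h i : 0 <= t * ((p ^ i)%:R - 1).
  by rewrite mulr_ge0// subr_ge0 ler1n expn_gt0 p0.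
have c i : (`|Num.ceil (t * ((p ^ i)%:R - 1))|%N)%:Z
           = Num.ceil (t * ((p ^ i)%:R - 1)).
  by rewrite gez0_abs// ceil_ge0 // (lt_le_trans _ (h i))// ltrN10.
rewrite -lez_nat PoszD PoszM !c ceil_le_int.
rewrite rmorphD rmorphM /=.
have -> : t * ((p ^ (e + f))%:R - 1) =
  (p ^ f)%:R * (t * ((p ^ e)%:R - 1)) + t * ((p ^ f)%:R - 1).
  rewrite expnD natrM !mulrBr !mulr1 addrA [_ * (t * _)]mulrCA.
  by rewrite [(p ^ f)%:R * (p ^ e)%:R]mulrC [(p ^ f)%:R * t]mulrC subrK.
by rewrite lerD ?ler_wpM2l ?ceil_ge.
Qed.

Lemma twist_cartier (D : nat -> set C) (a : set R) (t : RR) :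
  (0 < p)%N -> 0 <= t -> is_ideal a -> cartier_subalgebra p iota D ->
  cartier_subalgebra p iota (twist p iota D a t).
Proof.
move=> p0 t0 ha [D0 DB DM Ddir Ddeg Dfrob].
have DN e c : D e c -> D e (- c) by move=> ?; rewrite -sub0r; exact: DB.
have DD e c d : D e c -> D e d -> D e (c + d).
  by move=> ? ?; rewrite -[d]opprK; apply: DB => //; exact: DN.
have Dr e c r : D e c -> D e (c * iota r).
  by move=> ?; rewrite -[e]addn0; apply: DM => //; rewrite Ddeg; exists r.
have T0 e : twist p iota D a t e 0.
  by exists 0%N, (fun=> 0), (fun=> 0); split; [case|rewrite big_ord0].
have TD e c d : twist p iota D a t e c -> twist p iota D a t e d ->
    twist p iota D a t e (c + d).
  move=> [N [u [x [h ->]]]] [N' [u' [x' [h' ->]]]].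
  exists (N + N')%N,
    (fun j => match split j with inl i => u i | inr i => u' i end),
    (fun j => match split j with inl i => x i | inr i => x' i end); split.
    by move=> j; case: (split j).
  rewrite big_split_ord /=; congr (_ + _); apply: eq_bigr => i _.
    by rewrite (unsplitK (inl i : 'I_N + 'I_N')%type).
  by rewrite (unsplitK (inr i : 'I_N + 'I_N')%type).
have Ts e N (F : 'I_N -> C) : (forall i, twist p iota D a t e (F i)) ->
    twist p iota D a t e (\sum_(i < N) F i).
  by move=> hF; elim/big_ind: _ => // *; exact: TD.
have TN e c : twist p iota D a t e c -> twist p iota D a t e (- c).
  move=> [N [u [x [h ->]]]]; exists N, (fun j => - u j), x; split.
    by move=> j; have [? ?] := h j; split => //; exact: DN.
  by rewrite -sumrN; apply: eq_bigr => i _; rewrite mulNr.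
have TsubD e : twist p iota D a t e `<=` D e.
  move=> _ [N [u [x [h ->]]]]; elim/big_ind: _ => //; first exact: DD.
  by move=> i _; apply: Dr; case: (h i).
split=> //.
- by move=> e c d hc hd; apply: TD => //; exact: TN.
- move=> e f _ _ [N [u [x [h ->]]]] [N' [u' [x' [h' ->]]]].
  rewrite mulr_suml; apply: (Ts) => j; rewrite mulr_sumr; apply: Ts => j'.
  have [hu hx] := h j; have [hu' hx'] := h' j'.
  exists 1%N, (fun=> u j * u' j'), (fun=> x j ^+ (p ^ f) * x' j'); split.
    move=> _; split; first exact: DM.
    apply: (ideal_powerS ha (ceil_twist e f t0 p0)).
    by apply: ideal_powerM => //; exact: ideal_powerX.
  by rewrite big_ord1 rmorphM /= -!mulrA; congr (_ * _); rewrite !mulrA (Dfrob f).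
- by move=> N f hf; apply: Ddir => e; exact: TsubD.
- rewrite -Ddeg; apply/seteqP; split; first exact: TsubD.
  move=> c hc; exists 1%N, (fun=> c), (fun=> 1); split.
    by move=> _; split => //; rewrite expn0 subrr mulr0 ceil0; exact: ideal_power0.
  by rewrite big_ord1 rmorph1 mulr1.
- by move=> e c r /TsubD; exact: Dfrob.
Qed.

End Twist.

(* Main.v *)
(** If [t2 > t1] are jumping numbers then tau(t2) is properly contained in
tau(t1), so it suffices to find, for every [T], a finite-dimensional k-subspace
of [M] whose intersection with tau(t) generates tau(t) over [R] for all
[0 <= t <= T]: the dimensions of these intersections then separate the jumping
numbers below [T].

Let [G b] be the k-span of the elements of gauge at most [b]. As [a] is
generated in bounded degree (Dickson's lemma), an element [c] of degree
[e >= 1] of the twisted algebra is a sum of terms [r c'] with [c'] of the same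
degree and [c' G b <= G (b/2 + kappa)], where [kappa] depends on [T] only: split
a polynomial into terms [h s^(p^e)] with [h] of degree below [p^e] and move [s]
to the left. Consequently, with [d = 2 kappa], the operator C_+ preserves the
property of being generated over [R] by elements of [G d]; the chain C_+^n M has
this property, hence stabilizes, and its stable member [S] is finitely generated
with C_+ S = S.

If [N] is a submodule with the generic stalks of [S] then so is the R-span of
its intersection with [G d]: near a generic point, [u S <= N] for some [u], and
from [u S = u C_+ S <= C_+ (u S)] one gets generators of [u S] inside [N] of
gauge [b], then [b/2 + kappa], and eventually [d]. These submodules are closed
under finite intersections, so one whose intersection with [G d] has least
dimension yields the test module. *)
Require Import Defs.
From HB Require Import structures.
From mathcomp Require Import all_boot all_order all_algebra.
From mathcomp Require Import boolp classical_sets reals ereal topology normedtype.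
From mathcomp Require Import -(notations) mpoly.
From mathcomp Require Import ring zify.
From mathcomp Require Import cardinality.

Import Order.TTheory GRing.Theory Num.Theory.
Import numFieldNormedType.Exports.
Local Open Scope classical_set_scope.
Local Open Scope ring_scope.
Set Implicit Arguments.
Unset Strict Implicit.
Unset Printing Implicit Defensive.

(** * Polynomials of bounded multidegree *)

(** Finite sums of elements of [X]. The inductive form lets additive maps be applied term by term
    without indexing the summands. *)
Inductive add_closure (V : nmodType) (X : set V) : V -> Prop :=
| add_closure0 : add_closure X 0
| add_closureDl x y : X x -> add_closure X y -> add_closure X (x + y).

Section AddClosure.
Context {V : nmodType}.
Implicit Types X : set V.

Lemma add_closure_gen X x : X x -> add_closure X x.
Proof.
move=> Xx; rewrite -[x]addr0; apply: add_closureDl => //.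
exact: add_closure0.
Qed.

Lemma add_closureD X x y :
  add_closure X x -> add_closure X y -> add_closure X (x + y).
Proof.
move=> hx hy; elim: hx => [|u v Xu _ IH]; first by rewrite add0r.
by rewrite -addrA; exact: add_closureDl.
Qed.

Lemma add_closure_sum X I (r : seq I) (P : pred I) (F : I -> V) :
  (forall i, P i -> add_closure X (F i)) ->
  add_closure X (\sum_(i <- r | P i) F i).
Proof.
move=> h; elim/big_ind: _ => [|x y|]; last exact: h.
  exact: add_closure0.
exact: add_closureD.
Qed.

End AddClosure.

Lemma add_closure_map (V W : nmodType) (f : V -> W) (X : set V) (Y : set W) : f 0 = 0 ->
  {morph f : x y / x + y} -> (forall x, X x -> add_closure Y (f x)) ->
  forall x, add_closure X x -> add_closure Y (f x).
Proof.
move=> f0 fD h x; elim=> [|u v Xu _ IH].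
  by rewrite f0; exact: add_closure0.
by rewrite fD; apply: add_closureD => //; exact: h.
Qed.

Lemma add_closureM (S : pzRingType) (X Y Z : set S) x y :
  (forall x y, X x -> Y y -> add_closure Z (x * y)) ->
  add_closure X x -> add_closure Y y -> add_closure Z (x * y).
Proof.
move=> h hx hy.
apply: (add_closure_map (mul0r y) (fun u v => mulrDl u v y) _ hx) => u Xu.
by apply: (add_closure_map (mulr0 u) (mulrDr u) _ hy) => v; exact: h.
Qed.

(** Induction on [n], dropping the first coordinate. A bounded tail suffices once the first
    coordinate is large; the finitely many smaller first coordinates give slices that are treated
    separately. *)
Lemma dickson n (L : set ('I_n -> nat)) : exists B, forall l, L l ->
  exists b, [/\ L b, forall i, (b i <= l i)%N & forall i, (b i <= B)%N].
Proof.
elim: n L => [|n IH] L.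
  by exists 0%N => l Ll; exists l; split => // -[].
pose tl (l : 'I_n.+1 -> nat) i := l (lift ord0 i).
have [B hB] := IH [set v | exists2 l, L l & tl l = v].
(* [c w] is the first coordinate of some element of [L] over the tail [w], and 0 if there is
   none. *)
have /choice[c hc] : forall w : {ffun 'I_n -> 'I_B.+1}, exists c : nat,
    forall l, L l -> tl l = (fun i => w i : nat) ->
    exists l', [/\ L l', tl l' = (fun i => w i : nat) & (l' ord0 <= c)%N].
  move=> w; have [[l Ll lw]|h] :=
    pselect (exists2 l, L l & tl l = (fun i => w i : nat)).
    by exists (l ord0) => _ _ _; exists l.
  by exists 0%N => l Ll lw; case: h; exists l.
have /choice[Bs hBs] := fun c' : nat =>
  IH [set v | exists l, [/\ L l, l ord0 = c' & tl l = v]].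
pose cm := \max_w c w; pose Bm := \max_(j < cm) Bs j.
exists (maxn B (maxn cm Bm)) => l Ll.
have split_le (u v : 'I_n.+1 -> nat) : (u ord0 <= v ord0)%N ->
    (forall i, (tl u i <= tl v i)%N) -> forall i, (u i <= v i)%N.
  by move=> h0 h1 i; case: (unliftP ord0 i) => [j ->|->]//; exact: h1.
case: (ltnP (l ord0) cm) => hl.
  have [|_ [[b [Lb b0 <-]] bl bB]] := hBs (l ord0) (tl l); first by exists l.
  exists b; split => //; first by apply: split_le; rewrite ?b0.
  apply: (split_le _ (fun=> maxn B (maxn cm Bm))) => [|i].
    by rewrite b0 !leq_max (ltnW hl) orbT.
  rewrite !leq_max; apply/orP; right; apply/orP; right.
  by rewrite (leq_trans (bB i))// (leq_bigmax (Ordinal hl)).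
(* Here [l ord0] is at least [cm], so an element of [L] over a bounded tail below that of [l], with
   first coordinate at most [c w], lies below [l]. *)
have [|_ [[b1 Lb1 <-] bl bB]] := hB (tl l); first by exists l.
pose w : {ffun 'I_n -> 'I_B.+1} := [ffun i => inord (tl b1 i)].
have wE : tl b1 = (fun i => w i : nat).
  by apply/funext => i; rewrite ffunE inordK// ltnS.
have [b [Lb bw bc]] := hc w b1 Lb1 wE; rewrite -wE in bw.
have bcm : (b ord0 <= cm)%N by rewrite (leq_trans bc)// (leq_bigmax w).
exists b; split => //.
  apply: split_le => [|i]; first exact: leq_trans bcm hl.
  by rewrite bw.
apply: (split_le _ (fun=> maxn B (maxn cm Bm))) => [|i].
  by rewrite !leq_max bcm orbT.
by rewrite bw leq_max bB.
Qed.

Section BoundedMonomials.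
Context {k : fieldType} {n : nat}.
Implicit Types (f h : mpoly n k) (J : set (mpoly n k)).

Lemma bounded_monomials0 d : bounded_monomials d (0 : mpoly n k).
Proof. by move=> m; rewrite msupp0. Qed.

Lemma bounded_monomialsS d d' f : (d <= d')%N ->
  bounded_monomials d f -> bounded_monomials d' f.
Proof. by move=> dd' h m mf j; apply: leq_trans (h m mf j) dd'. Qed.

Lemma bounded_monomialsD d f h : bounded_monomials d f ->
  bounded_monomials d h -> bounded_monomials d (f + h).
Proof.
by move=> bf bh m /msuppD_le; rewrite mem_cat => /orP[/bf|/bh].
Qed.

Lemma bounded_monomialsM d d' f h : bounded_monomials d f ->
  bounded_monomials d' h -> bounded_monomials (d + d') (f * h).
Proof.
move=> bf bh m /msuppM_le/allpairsP[[m1 m2]/= [h1 h2 ->]] j.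
by rewrite mnmDE leq_add ?bf ?bh.
Qed.

Lemma bounded_monomialsCX d (c : k) (m : multinom n) : (forall j, m j <= d)%N ->
  bounded_monomials d (mpolyC n c * mpolyX k m).
Proof.
move=> md m'; rewrite mul_mpolyC => /msuppZ_le.
by rewrite msuppX inE => /eqP ->.
Qed.

Lemma bounded_monomials_msize f : bounded_monomials (mmeasure mdeg f) f.
Proof.
move=> m mf j; apply: (@leq_trans (mdeg m)); last exact/ltnW/msize_mdeg_lt.
by rewrite mdegE (bigD1 j)//= leq_addr.
Qed.

(** Division by a Groebner basis: Dickson's lemma gives finitely many elements of [J] whose leading
    monomials divide those of all nonzero elements of [J]. Subtracting multiples of them lowers the
    leading monomial, and the monomial order is well-founded. *)
Lemma mpoly_ideal_bounded J : is_ideal J -> exists A, forall f, J f ->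
  add_closure
    [set z | exists s h, [/\ J h, bounded_monomials A h & z = s * h]] f.
Proof.
move=> [J0 JD JM].
have [B hB] := dickson
  [set l : 'I_n -> nat | exists2 f, J f & f != 0 /\ l = mlead f].
have /choice[hw hwP] : forall w : {ffun 'I_n -> 'I_B.+1},
    exists h, forall f, J f -> f != 0 -> mlead f =1 (fun i => w i : nat) ->
    [/\ J h, h != 0 & mlead h = mlead f].
  move=> w; have [[h [h1 h2 h3]]|no] := pselect (exists h,
      [/\ J h, h != 0 & mlead h =1 (fun i => w i : nat)]).
    exists h => f _ _ fw; split => //; apply/mnmP => i.
    by rewrite h3 fw.
  by exists 0 => f ? ? ?; case: no; exists f.
pose A := \max_w mmeasure mdeg (hw w).
have step f : J f -> f != 0 -> exists h,
    [/\ J h, bounded_monomials A h, h != 0 & lem (mlead h) (mlead f)].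
  move=> Jf f0; have [|_ [[h Jh [h0 ->]] hle hBh]] := hB (mlead f).
    by exists f.
  pose w : {ffun 'I_n -> 'I_B.+1} := [ffun i => inord (mlead h i)].
  have [|J' n0 lE] := hwP w h Jh h0.
    by move=> i; rewrite ffunE inordK// ltnS.
  exists (hw w); split => //; last by rewrite lE; apply/mnm_lepP.
  have hA : (mmeasure mdeg (hw w) <= A)%N := leq_bigmax w.
  exact: bounded_monomialsS hA (@bounded_monomials_msize (hw w)).
exists A => f; move: {2}(mlead f) (erefl (mlead f)) => m.
elim/(well_founded_induction (@ltom_wf n)): m f => m IH f fm Jf.
have [->|f0] := eqVneq f 0; first exact: add_closure0.
have [h [Jh Ah h0 hf]] := step f Jf f0.
(* [s] is chosen so that [s * h] has the same leading term as [f]. *)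
pose s := mpolyC n (mleadc f / mleadc h) *
  mpolyX k (mnm_sub (mlead f) (mlead h)).
have c0 : mleadc f / mleadc h != 0.
  by rewrite mulf_neq0 ?invr_eq0 ?mleadc_eq0.
have shE : s * h = (mleadc f / mleadc h) *:
    (h * mpolyX k (mnm_sub (mlead f) (mlead h))).
  by rewrite -mul_mpolyC /s -mulrA [h * _]mulrC.
have lsh : mlead (s * h) = mlead f.
  rewrite shE mleadZ// mleadM ?mleadXm ?h0//; last first.
    by rewrite -mleadc_eq0 mleadXm mcoeffX eqxx oner_eq0.
  by rewrite addmC submK.
have csh : mcoeff (mlead f) (s * h) = mleadc f.
  rewrite shE mcoeffZ -{2}(submK hf) mcoeffMX mulfVK //.
  by rewrite mleadc_eq0.
rewrite -[f](subrK (s * h)); apply: add_closureD; last first.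
  by apply: add_closure_gen; exists s, h.
have [->|q0] := eqVneq (f - s * h) 0; first exact: add_closure0.
apply: (IH (mlead (f - s * h))) => //; last first.
  by apply: JD => //; rewrite -mulNr; exact: JM.
rewrite -fm lt_neqAle; apply/andP; split.
  apply: contra q0 => /eqP qE.
  by rewrite -mleadc_eq0 qE mcoeffB csh subrr.
by rewrite (le_trans (mleadB_le _ _))// lsh joinxx.
Qed.

End BoundedMonomials.

(** * Finite-dimensional pieces of the gauge filtration *)

(** A matrix of maximal rank among those with row space inside [W] works: adjoining a vector of [W]
    outside its row space would raise the rank. *)
Lemma subspace_row_space (F : fieldType) q (W : set 'rV[F]_q) : W 0 ->
  (forall x y, W x -> W y -> W (x + y)) -> (forall c x, W x -> W (c *: x)) ->
  exists A : 'M[F]_q, forall u, W u <-> (u <= A)%MS.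
Proof.
move=> W0 WD WZ.
pose P r := `[< exists A : 'M[F]_q,
  \rank A = r /\ forall u : 'rV_q, (u <= A)%MS -> W u >].
have P0 : exists r, P r.
  exists 0%N; apply/asboolP; exists 0; split; first exact: mxrank0.
  by move=> u; rewrite submx0 => /eqP ->.
have Pq r : P r -> (r <= q)%N by move=> /asboolP[A [<- _]]; exact: rank_leq_row.
case: (ex_maxnP P0 Pq) => r /asboolP[A [Ar AW]] rmax.
exists A => u; split; last exact: AW.
move=> Wu; apply: contrapT => /negP uA.
have : P (\rank (A + u)%MS).
  apply/asboolP; exists (A + u)%MS; split => // w.
  move=> /sub_addsmxP[[B c] ->] /=; apply: WD.
    by apply: AW; exact: submxMl.
  by rewrite [c]mx11_scalar mul_scalar_mx; exact: WZ.
move=> /rmax; rewrite leqNgt -Ar ltn_neqAle negb_and => /orP[|]; last first.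
  by rewrite mxrankS// addsmxSl.
rewrite negbK => /eqP rE; move/negP: uA; apply.
have /eqmxP/eqmx_sym AE : (A == A + u)%MS.
  by rewrite -(eq_leqif (mxrank_leqif_eq (addsmxSl A u))) rE.
by rewrite -AE addsmxSr.
Qed.

Section GaugePieces.
Variables (R : comPzRingType) (C : pzRingType) (iota : {rmorphism R -> C}).
Variables (M : lmodType C) (k : fieldType) (n : nat).
Variables (pi : {rmorphism mpoly n k -> R}) (l : nat) (g : 'I_l -> M).
Implicit Types (r : R) (m : M) (c : k).

Let G d := gauge_filtration iota pi g (Some d).

Lemma rscaleDr r : {morph rscale iota r : m m' / m + m' : M}.
Proof. by move=> m m'; rewrite /rscale scalerDr. Qed.

Lemma rscaleDl r r' m :
  rscale iota (r + r') m = rscale iota r m + rscale iota r' m.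
Proof. by rewrite /rscale rmorphD scalerDl. Qed.

Lemma rscaleA r r' m :
  rscale iota r (rscale iota r' m) = rscale iota (r * r') m.
Proof. by rewrite /rscale rmorphM scalerA. Qed.

Lemma rscale0r m : rscale iota 0 m = 0.
Proof. by rewrite /rscale rmorph0 scale0r. Qed.

Lemma rscaler0 r : rscale iota r (0 : M) = 0.
Proof. by rewrite /rscale scaler0. Qed.

Lemma rscale1 m : rscale iota 1 m = m.
Proof. by rewrite /rscale rmorph1 scale1r. Qed.

Lemma rscale_sumr I (s : seq I) (F : I -> M) r :
  rscale iota r (\sum_(i <- s) F i) =
    \sum_(i <- s) rscale iota r (F i).
Proof. by rewrite /rscale scaler_sumr. Qed.

Lemma rscale_suml I (s : seq I) (F : I -> R) m :
  rscale iota (\sum_(i <- s) F i) m =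
    \sum_(i <- s) rscale iota (F i) m.
Proof. by rewrite /rscale rmorph_sum scaler_suml. Qed.

Lemma gauge_filtration0 d : G d 0.
Proof.
exists (fun=> 0); split; first by move=> i; exact: bounded_monomials0.
by rewrite big1// => i _; rewrite rmorph0 rscale0r.
Qed.

Lemma gauge_filtrationD d m m' : G d m -> G d m' -> G d (m + m').
Proof.
move=> [s [hs ->]] [s' [hs' ->]]; exists (fun i => s i + s' i); split.
  by move=> i; exact: bounded_monomialsD.
by rewrite -big_split; apply: eq_bigr => i _; rewrite rmorphD rscaleDl.
Qed.

Lemma gauge_filtrationS d d' m : (d <= d')%N -> G d m -> G d' m.
Proof.
move=> dd' [s [hs ->]]; exists s; split => // i.
exact: bounded_monomialsS dd' (hs i).
Qed.

Lemma gauge_filtrationZ d d' h m : bounded_monomials d' h -> G d m ->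
  G (d + d') (rscale iota (pi h) m).
Proof.
move=> hh [s [hs ->]]; exists (fun i => h * s i); split.
  by move=> i; rewrite addnC; exact: bounded_monomialsM.
rewrite rscale_sumr; apply: eq_bigr => i _.
by rewrite rscaleA rmorphM.
Qed.

(** [M] is a module over [C] only; scalars of [k] act as constant polynomials, through [pi] and
    [iota]. *)
Definition k_subspace (V : set M) : Prop :=
  [/\ V 0, forall m m', V m -> V m' -> V (m + m') &
      forall c m, V m -> V (rscale iota (pi (mpolyC n c)) m)].

Lemma gauge_filtration_k_subspace d : k_subspace (G d).
Proof.
split; first exact: gauge_filtration0; first exact: gauge_filtrationD.
move=> c m Gm; rewrite -[d]addn0; apply: gauge_filtrationZ => // m'.
by rewrite msuppC; case: eqP => // _; rewrite inE => /eqP -> j; rewrite mnm0E.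
Qed.

(** Coordinates are pairs of a generator and an exponent vector with entries at most [d]. The
    generators may satisfy relations, so [L] need not be injective. *)
Lemma gauge_filtration_linear_image d : exists q (L : 'rV[k]_q -> M),
  [/\ L 0 = 0, {morph L : x y / x + y},
      forall c x, L (c *: x) = rscale iota (pi (mpolyC n c)) (L x) &
      G d `<=` range L].
Proof.
pose I := ('I_l * {ffun 'I_n -> 'I_d.+1})%type.
pose mn (w : {ffun 'I_n -> 'I_d.+1}) : multinom n :=
  Multinom (mktuple (fun j => w j : nat)).
pose L (v : 'rV[k]_#|{: I}|) := \sum_(i : I)
  rscale iota (pi (mpolyC n (v 0 (enum_rank i)) * mpolyX k (mn i.2))) (g i.1).
have LD : {morph L : x y / x + y}.
  move=> x y; rewrite -big_split; apply: eq_bigr => i _ /=.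
  by rewrite mxE mpolyCD mulrDl rmorphD rscaleDl.
have LZ c x : L (c *: x) = rscale iota (pi (mpolyC n c)) (L x).
  rewrite rscale_sumr; apply: eq_bigr => i _ /=.
  by rewrite mxE rscaleA mpolyCM -mulrA rmorphM.
have L0 : L 0 = 0.
  by rewrite -(scale0r 0) LZ mpolyC0 rmorph0 rscale0r.
exists #|{: I}|, L; split => // _ [s [hs ->]].
have imD x y : range L x -> range L y -> range L (x + y).
  by move=> [u _ <-] [v _ <-]; exists (u + v).
have im0 : range L 0 by exists 0.
elim/big_ind: _ => // i _; rewrite [s i]mpolyE rmorph_sum rscale_suml big_seq.
elim/big_ind: _ => // m ms.
pose w : {ffun 'I_n -> 'I_d.+1} := [ffun j => inord (m j)].
have wE : mn w = m.
  apply/mnmP => j; rewrite mnm_tnth /= tnth_mktuple ffunE inordK// ltnS.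
  exact: (hs i m ms j).
exists (mcoeff m (s i) *: delta_mx 0 (enum_rank (i, w))) => //.
rewrite LZ -mul_mpolyC rmorphM -rscaleA; congr rscale.
rewrite /L (bigD1 (i, w))//= big1 ?addr0 => [|[i' w'] ne].
  by rewrite wE mxE !eqxx mpolyC1 mul1r.
rewrite mxE eqxx /= (inj_eq enum_rank_inj) (negPf ne).
by rewrite mpolyC0 mul0r rmorph0 rscale0r.
Qed.

(** One map [L] serves all [V], so the ranks of the preimages of different subspaces can be
    compared. *)
Lemma gauge_subspace_preimage d : exists q (L : 'rV[k]_q -> M)
    (A : set M -> 'M[k]_q), [/\ G d `<=` range L,
    forall V, k_subspace V -> forall u, V (L u) <-> (u <= A V)%MS &
    forall N (u : 'I_N -> 'rV_q) (a : 'I_N -> k), L (\sum_i a i *: u i) =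
      \sum_i rscale iota (pi (mpolyC n (a i))) (L (u i))].
Proof.
have [q [L [L0 LD LZ GL]]] := gauge_filtration_linear_image d.
exists q, L.
have /choice[A hA] : forall V, exists A : 'M[k]_q,
    k_subspace V -> forall u, V (L u) <-> (u <= A)%MS.
  move=> V; have [[V0 VD VZ]|no] := pselect (k_subspace V); last by exists 0.
  have [||x a|A hA] := @subspace_row_space k q [set u | V (L u)].
  - by rewrite /= L0.
  - by move=> x y /= Vx Vy; rewrite LD; exact: VD.
  - by move=> Va /=; rewrite LZ; exact: VZ.
  - by exists A => _ u; exact: hA.
exists A; split => // N u a.
have -> : L (\sum_i a i *: u i) = \sum_i L (a i *: u i) by exact: (big_morph L).
by apply: eq_bigr => i _; rewrite LZ.
Qed.

(** [dm V] is the dimension of the preimage of [V] under [L]. The kernel of [L] adds the same amount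
    for every subspace, so strict inclusions inside [G d] remain visible. *)
Lemma gauge_subspace_dim d : exists q (dm : set M -> nat),
  (forall V, (dm V <= q)%N) /\ forall V W, k_subspace V -> k_subspace W ->
    W `<=` G d -> V `<` W -> (dm V < dm W)%N.
Proof.
have [q [L [A [GL hA _]]]] := gauge_subspace_preimage d.
exists q, (fun V => \rank (A V)); split => [V|V W hV hW WG VW].
  exact: rank_leq_row.
case: VW => VW /existsNP[x /not_implyP[Wx Vx]].
have [u _ ux] := GL _ (WG _ Wx).
apply: rank_ltmx; rewrite /ltmx; apply/andP; split.
  apply/row_subP => i; apply/(hA W hW)/VW/(hA V hV); exact: row_sub.
apply/negP => WAV; apply: Vx; rewrite -ux; apply/(hA V hV).
by apply: submx_trans WAV; apply/(hA W hW); rewrite ux.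
Qed.

Lemma gauge_subspace_fg d V : k_subspace V -> V `<=` G d ->
  exists q (v : 'I_q -> M), (forall i, V (v i)) /\ forall m, V m ->
    exists a : 'I_q -> k, m = \sum_i rscale iota (pi (mpolyC n (a i))) (v i).
Proof.
move=> hV VG; have [q [L [A [GL hA Lsum]]]] := gauge_subspace_preimage d.
exists q, (fun i => L (row i (A V))); split.
  by move=> i; apply/(hA V hV); exact: row_sub.
move=> m Vm; have [u _ um] := GL _ (VG _ Vm).
have /submxP[a uE] : (u <= A V)%MS by apply/(hA V hV); rewrite um.
exists (a 0); rewrite -Lsum -um; congr L.
by rewrite uE mulmx_sum_row.
Qed.

End GaugePieces.

(** * Contraction of the gauge by a twisted Cartier algebra *)

Section Contraction.
Variables (p : nat) (R : comPzRingType) (C : pzRingType).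
Variables (iota : {rmorphism R -> C}) (D : nat -> set C).

Lemma homogeneous_generators (J : Type) (ev : J -> nat) (psi : J -> C) e c :
  cartier_subalgebra p iota D -> right_generates iota (graded_plus D) psi ->
  (forall i, D (ev i) (psi i)) -> (0 < e)%N -> D e c ->
  add_closure [set z | exists i r, ev i = e /\ z = psi i * iota r] c.
Proof.
move=> [D0 DB DM Ddir Ddeg _] [_ psi_gen] Dpsi e0 Dc.
have DD d x y : D d x -> D d y -> D d (x + y).
  move=> hx hy; rewrite -[y]opprK -[- y]sub0r; apply: (DB) => //.
  exact: DB.
have sumc N : (e < N)%N -> \sum_(0 <= d < N) (if d == e then c else 0) = c.
  move=> eN; rewrite big_mkord (bigD1 (Ordinal eN))//= eqxx big1 ?addr0// => d.
  by rewrite -val_eqE /= => /negPf ->.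
have [|N [i [r cE]]] := psi_gen c.
  exists e.+1, (fun d => if d == e then c else 0); split.
    by move=> d; case: eqP => [->|].
  by rewrite -{1}(sumc e.+1)// big_ltn// ltn_eqF// add0r.
pose F d := \sum_(j < N | ev (i j) == d) psi (i j) * iota (r j).
(* [B] exceeds [e] and the degree of every term in the expression of [c]. *)
pose B := (e + \sum_(j < N) ev (i j)).+1.
have FE : \sum_(0 <= d < B) F d = c.
  rewrite big_mkord /F cE.
  under eq_bigr do rewrite big_mkcond.
  rewrite exchange_big; apply: eq_bigr => j _ /=.
  have jB : (ev (i j) < B)%N.
    by rewrite /B ltnS (bigD1 j)//= addnCA leq_addr.
  rewrite (bigD1 (Ordinal jB))//= eqxx big1 ?addr0// => d.
  by rewrite -val_eqE /= eq_sym => /negPf ->.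
have eB : (e < B)%N by rewrite ltnS leq_addr.
have : F e - (if e == e then c else 0) = 0.
  apply: (Ddir B (fun d => F d - (if d == e then c else 0)) _ _ e eB) =>
    [d|].
    apply: DB; last by case: eqP => [->|].
    rewrite /F; elim/big_ind: _ => //; first exact: DD.
    move=> j /eqP <-; rewrite -[ev (i j)]addn0; apply: DM => //.
    by rewrite Ddeg; exists (r j).
  by rewrite sumrB FE (sumc _ eB) subrr.
rewrite eqxx => /subr0_eq <-; apply: add_closure_sum => j /eqP je.
by apply: add_closure_gen; exists (i j), (r j).
Qed.

End Contraction.

(** Each exponent is divided by [q] with remainder: the remainders and the coefficient go into [h],
    the quotients into [s]. *)
Lemma mpoly_expn_decomposition (k : fieldType) n q (f : mpoly n k) :
  (0 < q)%N -> add_closure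
    [set z | exists h s, bounded_monomials q.-1 h /\ z = h * s ^+ q] f.
Proof.
move=> q0; rewrite [f]mpolyE; apply: add_closure_sum => m _.
apply: add_closure_gen.
pose mr := Multinom (mktuple (fun j => m j %% q)%N).
pose mq := Multinom (mktuple (fun j => m j %/ q)%N).
exists (mpolyC n (mcoeff m f) * mpolyX k mr), (mpolyX k mq); split.
  apply: bounded_monomialsCX => j.
  by rewrite mnm_tnth /= tnth_mktuple -ltnS prednK// ltn_pmod.
rewrite mpolyXn -mulrA -mpolyXD -mul_mpolyC; congr (_ * mpolyX _ _).
apply/mnmP => j; rewrite mnmDE mulmnE !mnm_tnth /= !tnth_mktuple.
by rewrite addnC -divn_eq.
Qed.

(** * Generators of ideal powers in bounded degree *)

Section IdealPower.
Variables (k : fieldType) (n : nat) (R : comPzRingType).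
Variables (pi : {rmorphism mpoly n k -> R}) (hpi : range pi = setT).

Lemma ideal_generated_in_bounded_degree (a : set R) : is_ideal a ->
  exists A, forall x, a x -> add_closure
    [set z | exists r h, [/\ bounded_monomials A h, a (pi h) & z = r * pi h]] x.
Proof.
move=> [a0 aD aM].
have [|A hA] := @mpoly_ideal_bounded k n [set f | a (pi f)].
  split; first by rewrite /= rmorph0.
    by move=> x y ? ?; rewrite /= rmorphD; exact: aD.
  by move=> r x ?; rewrite /= rmorphM; exact: aM.
exists A => x; have [f _ <-] : range pi x by rewrite hpi.
move=> /hA; apply: add_closure_map; first exact: rmorph0.
  exact: rmorphD.
move=> _ [s [h [ah Ah ->]]]; apply: add_closure_gen; exists (pi s), h.
by split => //; exact: rmorphM.
Qed.

(** Multidegree bounds add up in a product of [m] bounded elements of [a]. *)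
Lemma ideal_power_bounded_degree (a : set R) A m x :
  (forall x, a x -> add_closure
    [set z | exists r h,
      [/\ bounded_monomials A h, a (pi h) & z = r * pi h]] x) ->
  ideal_power a m x -> add_closure
    [set z | exists r h, [/\ bounded_monomials (m * A) h,
       ideal_power a m (pi h) & z = r * pi h]] x.
Proof.
move=> hA [N [r [y [ay ->]]]]; apply: add_closure_sum => j _.
have : add_closure
    [set z | exists r h, [/\ bounded_monomials (m * A) h,
       ideal_power a m (pi h) & z = r * pi h]] (\prod_(i < m) y j i).
  move: (y j) (ay j) => {y ay}; elim: m => [|m IH] u au.
    rewrite big_ord0; apply: add_closure_gen; exists 1, 1; split; last by rewrite rmorph1 mulr1.
      move=> i; rewrite msupp1 inE => /eqP -> i'; by rewrite mnm0E.
    exact: ideal_power0.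
  rewrite big_ord_recl.
  have hu := IH _ (fun i => au (lift ord0 i)).
  apply: (add_closureM _ (hA _ (au ord0)) hu).
  move=> _ _ [r1 [h1 [b1 a1 ->]]] [r2 [h2 [b2 a2 ->]]].
  apply: add_closure_gen; exists (r1 * r2), (h1 * h2); split.
  - by rewrite mulSn; exact: bounded_monomialsM.
  - rewrite rmorphM -[m.+1]add1n; apply: ideal_powerM => //.
    exists 1%N, (fun=> 1), (fun _ _ => pi h1); split => //.
    by rewrite !big_ord1 mul1r.
  - by rewrite rmorphM mulrACA.
apply: add_closure_map; first exact: mulr0.
  by move=> z z'; exact: mulrDr.
move=> _ [r1 [h [bh ah ->]]]; apply: add_closure_gen.
by exists (r j * r1), h; split => //; rewrite mulrA.
Qed.

End IdealPower.

(* [kappa] does not depend on the degree e >= 1, and b./2 bounds b %/ p ^ e. *)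
Definition contracting (R : comPzRingType) (C : pzRingType)
    (iota : {rmorphism R -> C}) (M : lmodType C) (k : fieldType) (n : nat)
    (pi : {rmorphism mpoly n k -> R}) (l : nat) (g : 'I_l -> M)
    (D : nat -> set C) (kappa : nat) : Prop :=
  forall e c, (0 < e)%N -> D e c -> add_closure
    [set z | exists r c', [/\ D e c', z = iota r * c' &
      forall b x, gauge_filtration iota pi g (Some b) x ->
        gauge_filtration iota pi g (Some (b./2 + kappa)%N) (c' *: x)]] c.

Section TwistContracting.
Variables (RR : realType) (p : nat) (k : fieldType) (p_prime : prime p).
Variables (n : nat) (R : comPzRingType) (pi : {rmorphism mpoly n k -> R}).
Hypothesis hpi : range pi = setT.
Variables (C : pzRingType) (iota : {rmorphism R -> C}) (D : nat -> set C).
Hypothesis hD : cartier_subalgebra p iota D.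
Variables (M : lmodType C) (l : nat) (g : 'I_l -> M).
Variables (a : set R) (ha : is_ideal a).
Variables (delta : M -> option nat) (hdelta : is_gauge iota pi RR g delta).

Local Notation G d := (gauge_filtration iota pi g (Some d)).

Lemma gauge_val_le d m : G d m -> (gauge_val RR (delta m) <= (d%:R)%:E)%E.
Proof. by move=> Gm; have [_ /(_ (Some d))] := hdelta m; apply. Qed.

Lemma gauge_filtration_gauge_val d m :
  (gauge_val RR (delta m) <= (d%:R)%:E)%E -> G d m.
Proof.
have [+ _] := hdelta m; case: (delta m) => [d'|] Gm.
  by rewrite lee_fin ler_nat => /gauge_filtrationS; apply.
by rewrite Gm => _; exact: gauge_filtration0.
Qed.

Lemma gauge_bound_contracts (q : nat) (psi : C) (K : RR) (K0 d d0 : nat) x :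
  (0 < q)%N -> K <= K0%:R -> (d <= q * d0)%N ->
  (forall m, (gauge_val RR (delta (psi *: m)) <=
     gauge_val RR (delta m) * (q%:R^-1)%:E + K%:E)%E) ->
  G d x -> G (d0 + K0) (psi *: x).
Proof.
move=> q0 KK0 dd0 hpsi Gx; apply: gauge_filtration_gauge_val.
apply: (le_trans (hpsi x)).
(* If the gauge of [x] is -oo, so is the bound for the image. *)
have := gauge_val_le Gx; case: (delta x) => [d'|] /=; last first.
  by move=> _; rewrite gt0_mulNye ?lte_fin ?invr_gt0 ?ltr0n// addNye leNye.
rewrite lee_fin ler_nat => d'd; rewrite -EFinM -EFinD lee_fin natrD lerD//.
rewrite ler_pdivrMr ?ltr0n// mulrC -natrM ler_nat.
exact: leq_trans dd0.
Qed.

(** The multidegrees of the remainder [h'] and of the factor [f] from the power of [a] grow at most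
    like p^e, while [psi i] divides gauges by p^e. Their contribution is therefore bounded uniformly
    in [e] and [t]. *)
Lemma twist_contracting (J : Type) (ev : J -> nat) (psi : J -> C) (K : RR)
    (T : nat) : right_generates iota (graded_plus D) psi ->
  (forall i, D (ev i) (psi i)) ->
  (forall i m, (gauge_val RR (delta (psi i *: m)) <=
     gauge_val RR (delta m) * ((p ^ ev i)%:R^-1)%:E + K%:E)%E) ->
  exists kappa, forall t : RR, 0 <= t <= T%:R ->
    contracting iota pi g (twist p iota D a t) kappa.
Proof.
move=> psi_gen psiD psiK.
have [D0 DB DM Ddir Ddeg Dfrob] := hD.
have [A hA] := ideal_generated_in_bounded_degree hpi ha.
pose K0 := Num.bound `|K|.
(* After division by p^e, [A * T] accounts for [f], one unit for [h'] and one for the remainder of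
   [b] modulo p^e; [K0] bounds the additive constant. *)
exists ((A * T).+2 + K0)%N => t /andP[t0 tT] e _ e0 [N [phi [x [h ->]]]].
apply: add_closure_sum => j _; have [Dphi ax] := h j => {h}.
set m := `|Num.ceil _|%N in ax.
have pe0 : (0 < p ^ e)%N by rewrite expn_gt0 prime_gt0.
(* As [T] is an integer, the bound T (p^e - 1) on t (p^e - 1) survives rounding up. *)
have mT : (m <= T * (p ^ e).-1)%N.
  have q1 : 0 <= (p ^ e)%:R - 1 :> RR by rewrite subr_ge0 ler1n.
  rewrite -lez_nat /m gez0_abs; last first.
    by rewrite ceil_ge0 (lt_le_trans (ltrN10 _))// mulr_ge0.
  rewrite ceil_le_int PoszM rmorphM /= -subn1 -subzn// rmorphB /=.
  by rewrite ler_wpM2r.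
have hx : add_closure [set z | exists r f, [/\ bounded_monomials (m * A) f,
    ideal_power a m (pi f) & z = iota (r * pi f)]] (iota (x j)).
  apply: (add_closure_map (rmorph0 iota) (rmorphD iota) _
    (ideal_power_bounded_degree hA ax)).
  move=> _ [r [f [bf af ->]]]; apply: add_closure_gen.
  by exists r, f.
apply: (add_closureM _ (homogeneous_generators hD psi_gen psiD e0 Dphi) hx).
move=> _ _ [i [r [ie ->]]] [r' [f [bf af ->]]].
rewrite -mulrA -rmorphM mulrA.
have [h _ <-] : range pi (r * r') by rewrite hpi.
apply: (add_closure_map (f := fun h => psi i * iota (pi h * pi f)) _ _ _
  (mpoly_expn_decomposition h pe0)).
- by rewrite rmorph0 mul0r rmorph0 mulr0.
- by move=> u v; rewrite rmorphD mulrDl rmorphD mulrDr.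
move=> _ [h' [s [bh' ->]]]; apply: add_closure_gen.
exists (pi s), (psi i * iota (pi (h' * f))); split.
- exists 1%N, (fun=> psi i), (fun=> pi (h' * f)); split; last by rewrite big_ord1.
  move=> _; rewrite -{1}ie; split => //.
  have [_ _ aM] := ideal_power_ideal a m.
  by rewrite rmorphM; exact: aM.
(* [pi s] occurs with exponent p^e, so the Frobenius relation carries it to the left of [psi i]. *)
- rewrite [RHS]mulrA (Dfrob _ _ _ (psiD i)) -[RHS]mulrA -(rmorphM iota).
  congr (_ * iota _); rewrite ie.
  by rewrite !rmorphM rmorphXn; ring.
move=> b y Gy.
rewrite -scalerA.
have bhf : bounded_monomials ((p ^ e).-1 + m * A) (h' * f).
  exact: bounded_monomialsM.
have Gy' := gauge_filtrationZ bhf Gy.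
have K0P : K <= K0%:R.
  by rewrite (le_trans (ler_norm K))// ltW// archi_boundP.
apply: (gauge_filtrationS (d := (b %/ p ^ e + (A * T).+2) + K0)).
  rewrite -addnA leq_add2r -divn2 leq_div2l// (leq_trans (prime_gt1 p_prime))//.
  by rewrite -{1}[p]expn1 leq_exp2l// prime_gt1.
apply: (gauge_bound_contracts _ K0P _ (psiK i) Gy').
  by rewrite expn_gt0 prime_gt0.
rewrite ie.
nia.
Qed.
End TwistContracting.

(** * Stable members and test modules *)

Section TestModules.
Variables (p : nat) (R : comPzRingType) (C : pzRingType).
Variables (iota : {rmorphism R -> C}) (D : nat -> set C).
Hypotheses (p_prime : prime p) (hD : cartier_subalgebra p iota D).
Variables (M : lmodType C) (k : fieldType) (n : nat).
Variables (pi : {rmorphism mpoly n k -> R}) (l : nat) (g : 'I_l -> M).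
Hypotheses (hpi : range pi = setT) (hg : R_generates iota g).
Variables (kappa : nat).
Hypothesis hcontr : contracting iota pi g D kappa.
Implicit Types (N X Y : set M) (r : R) (x m : M) (c : C).

Local Notation G b := (gauge_filtration iota pi g (Some b)).
Local Notation d := (kappa + kappa)%N.
Local Notation S := (stable_member D : set M).

(** An inclusion of [N] in [core N b] expresses that [N] is generated over [R] in gauge at most
    [b]. *)
Definition core X b : set M :=
  add_closure [set z | exists r x, [/\ X x, G b x & z = rscale iota r x]].

Definition R_submodule N : Prop :=
  [/\ N 0, forall x y, N x -> N y -> N (x + y) &
      forall r x, N x -> N (rscale iota r x)].

Lemma add_closure_subset N X : R_submodule N -> X `<=` N ->
  add_closure X `<=` N.
Proof.
by move=> [N0 ND _] XN x; elim=> // u v /XN Nu _ Nv; exact: ND.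
Qed.

Lemma is_submoduleP N : is_submodule D N <->
  [/\ N 0, forall x y, N x -> N y -> N (x + y) &
      forall e c x, D e c -> N x -> N (c *: x)].
Proof.
have D0 := piece0 hD.
split=> -[N0 ND NM]; split => //.
  move=> e c x Dc; apply: NM.
  exists e.+1, (fun i => if i == e then c else 0); split.
    by move=> i; case: eqP => [->|].
  rewrite big_nat_recr//= eqxx big_nat big1 ?add0r// => i /andP[_ ie].
  by rewrite ltn_eqF.
move=> _ x [q [f [Df ->]]] Nx; rewrite scaler_suml.
by elim/big_ind: _ => // i _; exact: NM _ _ _ (Df i) Nx.
Qed.

Lemma is_submodule_R N : is_submodule D N -> R_submodule N.
Proof.
move=> /is_submoduleP[N0 ND NM]; split => // r x; apply: (NM 0%N).
by rewrite (piece_deg0 hD); exists r.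
Qed.

Lemma piece_mulr e c r : D e c -> D e (c * iota r).
Proof.
move=> Dc; rewrite -[e]addn0; apply: (pieceM hD) => //.
by rewrite (piece_deg0 hD); exists r.
Qed.

Lemma core_R_submodule X b : R_submodule (core X b).
Proof.
split; [exact: add_closure0|exact: add_closureD|move=> r x].
apply: add_closure_map; [exact: rscaler0|exact: rscaleDr|].
move=> _ [r' [y [Xy Gy ->]]]; apply: add_closure_gen.
by exists (r * r'), y; rewrite rscaleA.
Qed.

Lemma core_gen X b x : X x -> G b x -> core X b x.
Proof.
by move=> Xx Gx; apply: add_closure_gen; exists 1, x; rewrite rscale1.
Qed.

Lemma core_subset N X b : R_submodule N -> X `&` G b `<=` N -> core X b `<=` N.
Proof.
move=> hN XN; apply: add_closure_subset => // _ [r [x [Xx Gx ->]]].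
by case: hN => _ _ NZ; apply/NZ/XN.
Qed.

Lemma coreS X Y b b' : (b <= b')%N -> X `<=` Y -> core X b `<=` core Y b'.
Proof.
move=> bb' XY; apply: core_subset; first exact: core_R_submodule.
by move=> x [/XY Yx Gx]; apply: core_gen => //; exact: gauge_filtrationS Gx.
Qed.

(** The coefficients of the given element are absorbed by [c] on the right, which keeps its degree
    [e]; [contracting] then produces new coefficients on the left. *)
Lemma core_contracts X Y e c b x : (0 < e)%N ->
  (forall c' y, D e c' -> X y -> Y (c' *: y)) -> D e c -> core X b x ->
  core Y (b./2 + kappa) (c *: x).
Proof.
move=> e0 XY Dc; apply: add_closure_map; [exact: scaler0|exact: scalerDr|].
move=> _ [r [y [Xy Gy ->]]]; rewrite /rscale scalerA.
apply: (add_closure_map (f := fun c => c *: y) _ _ _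
  (hcontr e0 (piece_mulr r Dc))); first exact: scale0r.
  by move=> u v; rewrite scalerDl.
move=> _ [r' [c' [Dc' -> hc']]]; apply: add_closure_gen.
exists r', (c' *: y); split; [exact: XY|exact: hc'|].
by rewrite /rscale scalerA.
Qed.

(** The value 2 [kappa] is a fixed point of the map from [b] to [b./2 + kappa]. *)
Lemma core_d_contracts X Y e c x : (0 < e)%N ->
  (forall c' y, D e c' -> X y -> Y (c' *: y)) -> D e c -> core X d x ->
  core Y d (c *: x).
Proof.
move=> e0 XY Dc /(core_contracts e0 XY Dc).
by rewrite addnn doubleK -addnn.
Qed.

Lemma core_submodule N : is_submodule D N -> is_submodule D (core N d).
Proof.
move=> /is_submoduleP[_ _ NM]; have [c0 cD cZ] := core_R_submodule N d.
apply/is_submoduleP; split => // e c x; case: (posnP e) => [->|e0].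
  by rewrite (piece_deg0 hD) => -[r _ <-]; exact: cZ.
by move=> Dc; apply: (core_d_contracts e0) => //; exact: NM.
Qed.

Lemma k_subspace_gauge N b : R_submodule N ->
  k_subspace iota pi (N `&` G b).
Proof.
move=> [N0 ND NZ].
have [G0 GD GZ] := gauge_filtration_k_subspace iota pi g b.
by split=> [|x y [? ?] [? ?]|c x [? ?]]; split;
  by [|exact: ND|exact: GD|exact: NZ|exact: GZ].
Qed.

(** * The iterates of C_+ and the stable member *)

(** This is C_+ N: the additive span is already a submodule, since a product of homogeneous elements
    is homogeneous and its degree stays positive. *)
Definition plus_image N : set M :=
  add_closure [set z | exists e c x, [/\ (0 < e)%N, D e c, N x & z = c *: x]].

Lemma plus_image_gen N e c x : (0 < e)%N -> D e c -> N x ->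
  plus_image N (c *: x).
Proof. by move=> ? ? ?; apply: add_closure_gen; exists e, c, x. Qed.

Lemma plus_image_submodule N : is_submodule D (plus_image N).
Proof.
apply/is_submoduleP; split; [exact: add_closure0|exact: add_closureD|].
move=> e c x Dc; apply: add_closure_map; [exact: scaler0|exact: scalerDr|].
move=> _ [e' [c' [y [e0 Dc' Ny ->]]]]; rewrite scalerA.
apply: (@plus_image_gen _ (e + e')%N) => //; first by rewrite addn_gt0 e0 orbT.
exact: (pieceM hD).
Qed.

Lemma plus_image_subset N : is_submodule D N -> plus_image N `<=` N.
Proof.
move=> hN; apply: add_closure_subset; first exact: is_submodule_R.
move=> _ [e [c [x [_ Dc Nx ->]]]]; have /is_submoduleP[_ _ NM] := hN.
exact: NM _ _ _ Dc Nx.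
Qed.

Lemma plus_image_core N : N `<=` core N d ->
  plus_image N `<=` core (plus_image N) d.
Proof.
move=> hN; apply: add_closure_subset; first exact: core_R_submodule.
move=> _ [e [c [x [e0 Dc /hN Nx ->]]]].
apply: (core_d_contracts e0 _ Dc Nx) => c' y Dc' Ny.
exact: plus_image_gen Dc' Ny.
Qed.

Let P i := iter i plus_image setT.

Lemma iter_plus_image_submodule i : is_submodule D (P i).
Proof. by case: i => [|i]; [split|exact: plus_image_submodule]. Qed.

Lemma iter_plus_image_decr i j : P (i + j) `<=` P i.
Proof.
elim: j => [|j IH]; first by rewrite addn0.
rewrite addnS; apply: subset_trans IH.
apply: plus_image_subset; exact: iter_plus_image_submodule.
Qed.

Lemma iter_plus_image_core i : P i `<=` core (P i) d.
Proof.
elim: i => [|i IH]; last exact: plus_image_core.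
(* [M] itself is generated in gauge at most [d], since each [g i] has constant coefficients. *)
move=> m _; have [r ->] := hg m; apply: add_closure_sum => i _.
apply: add_closure_gen; exists (r i), (g i); split => //.
exists (fun j => if j == i then 1 else 0); split.
  move=> j; case: eqP => _; last exact: bounded_monomials0.
  by move=> w; rewrite msupp1 inE => /eqP -> j'; rewrite mnm0E.
rewrite (bigD1 i)//= eqxx rmorph1 rscale1 big1 ?addr0// => j /negPf ->.
by rewrite rmorph0 rscale0r.
Qed.

Lemma plus_power_submodule i : is_submodule D (plus_power D i : set M).
Proof.
split.
- by move=> N [[]].
- move=> x y hx hy N hN; case: (hN) => -[_ ND _] _.
  by apply: ND; [exact: hx|exact: hy].
- move=> c x Dc hx N hN; case: (hN) => -[_ _ NM] _.
  by apply: NM => //; exact: hx.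
Qed.

(** Identifies the powers that define the stable member with the iterates of C_+, for which
    generation in bounded gauge passes from one step to the next. *)
Lemma plus_powerE i : plus_power D i = P i.
Proof.
apply/seteqP; split.
  apply: smallest_sub; first exact: iter_plus_image_submodule.
  move=> _ [phi [m [hphi ->]]]; elim: i phi hphi => [|i IH] phi hphi //.
  rewrite big_ord_recl -scalerA; have [q [f [Df ->]]] := hphi ord0.
  rewrite scaler_suml big_nat; apply: add_closure_sum => e /andP[e0 _].
  apply: add_closure_gen.
  exists e, (f e), (\prod_(j < i) phi (lift ord0 j) *: m).
  by split => //; exact: IH.
elim: i => [|i IH].
  move=> m _; apply: sub_gen_smallest.
  by exists (fun=> 0), m; split; [case|rewrite big_ord0 scale1r].
apply: add_closure_subset; first exact/is_submodule_R/plus_power_submodule.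
move=> _ [e [c [x [e0 Dc /IH hx ->]]]].
(* [Q] is a submodule containing the generators of [plus_power D i], hence all of it. *)
pose Q := [set x | forall e c, (0 < e)%N -> D e c ->
  plus_power D i.+1 (c *: x : M)].
suff QP : plus_power D i `<=` Q by exact: QP hx _ _ e0 Dc.
apply: smallest_sub.
  have [p0 pD _] := plus_power_submodule i.+1.
  apply/is_submoduleP; split.
  - by move=> e' c' _ _; rewrite scaler0.
  - by move=> y z Qy Qz e' c' ? ?; rewrite scalerDr; apply: pD;
      [exact: (Qy e' c')|exact: (Qz e' c')].
  - move=> e' c' y Dc' Qy e'' c'' e0'' Dc''; rewrite scalerA.
    apply: (Qy (e'' + e')%N); first by rewrite addn_gt0 e0''.
    exact: (pieceM hD).
move=> _ [phi [m [hphi ->]]] e' c' e0' Dc'; apply: sub_gen_smallest.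
exists (fun j => if unlift ord0 j is Some j' then phi j' else c'), m; split.
  move=> j; case: unliftP => [j' _|_]; first exact: hphi.
  exists e'.+1, (fun e => if e == e' then c' else 0); split.
    by move=> e1; case: eqP => [->|_]; [|exact: (piece0 hD)].
  rewrite big_nat_recr//= eqxx big_nat big1 ?add0r// => e1 /andP[_ h].
  by rewrite ltn_eqF.
rewrite big_ord_recl unlift_none scalerA; congr (_ * _ *: _).
by apply: eq_bigr => j _; rewrite liftK.
Qed.

(** The dimension of the part of [P i] in [G d] attains a least value. From there on these parts are
    constant, and each [P i] is generated by its part. *)
Lemma stable_memberP : [/\ is_submodule D S, S `<=` plus_image S &
  S `<=` core S d].
Proof.
have [q [dm [_ dmlt]]] := gauge_subspace_dim iota pi g d.
pose V i := P i `&` G d.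
have hV i : k_subspace iota pi (V i).
  exact/k_subspace_gauge/is_submodule_R/iter_plus_image_submodule.
have ex : exists v, `[< exists i, v = dm (V i) >].
  by exists (dm (V 0)); apply/asboolP; exists 0%N.
case: (ex_minnP ex) => v /asboolP[i ->] vmin.
have stab j : P i `<=` P (i + j).
  have VV : V i `<=` V (i + j)%N.
    apply: contrapT => nVV.
    suff: (dm (V (i + j)) < dm (V i))%N.
      by rewrite ltnNge vmin//; apply/asboolP; exists (i + j)%N.
    apply: dmlt => //; first by move=> x [].
    by split => // x [/iter_plus_image_decr ? ?].
  apply: (subset_trans (@iter_plus_image_core i)); apply: core_subset.
    exact/is_submodule_R/iter_plus_image_submodule.
  by move=> x /VV[].
have SE : S = P i.
  apply/seteqP; split => [x /(_ i I)|x Px j _]; rewrite plus_powerE//.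
  by apply: (@iter_plus_image_decr j i); rewrite addnC; exact: stab.
rewrite SE; split; first exact: iter_plus_image_submodule.
  by have := stab 1%N; rewrite addn1.
exact: iter_plus_image_core.
Qed.

(** * Generic stalks and the test module *)

(** An equality x/1 = m/s yields a denominator [u * s] that carries [x] into [N']; conversely x/s =
    (w x)/(w s). This replaces classes of fractions by denominators. *)
Lemma localize_subset (eta : set R) N N' : is_prime eta -> R_submodule N ->
  R_submodule N' -> localize iota eta N `<=` localize iota eta N' <->
  forall x, N x -> exists2 w, ~ eta w & N' (rscale iota w x).
Proof.
move=> [_ eta1 eta_prime] hN [N0' ND' NZ']; split.
  move=> h x Nx; have [m [s [N'm etas fE]]] : localize iota eta N'
      (Defs.frac iota eta x 1) by apply: h; exists x, 1.
  have : Defs.frac iota eta x 1 (x, 1).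
    by split => //; exists 1 => //; rewrite subrr rscaler0.
  rewrite fE => -[_ [u etau]] /=; rewrite rscale1.
  rewrite /rscale scalerBr => /subr0_eq.
  rewrite scalerA -rmorphM => E; exists (u * s).
    by move=> /eta_prime[].
  by rewrite /rscale E; exact: NZ'.
move=> h _ [x [s [Nx etas ->]]]; have [w etaw N'wx] := h x Nx.
exists (rscale iota w x), (w * s); split => //; first by move=> /eta_prime[].
(* The condition defining the class of (w x)/(w s) is that of x/s multiplied by [w], so the two
   classes agree. *)
have E u y v : rscale iota u (rscale iota (w * s) y -
    rscale iota v (rscale iota w x)) =
    rscale iota (u * w) (rscale iota s y - rscale iota v x).
  rewrite -[RHS]rscaleA; congr rscale; rewrite !rscaleA.
  by rewrite /rscale scalerBr !scalerA -!rmorphM [v * w]mulrC.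
apply/seteqP; split => -[y v] /= [etav [u etau]] /= H; split => //.
  exists u => //.
  by rewrite E mulrC -rscaleA H rscaler0.
by exists (u * w); [move=> /eta_prime[]|rewrite -E].
Qed.

Lemma generically_stableP N : is_submodule D N ->
  generically_stable iota D N <-> forall Z eta,
    irreducible_component (Defs.support iota S) Z -> generic_point Z eta ->
    (forall x, S x -> exists2 w, ~ eta w & N (rscale iota w x)) /\
    (forall x, N x -> exists2 w, ~ eta w & S (rscale iota w x)).
Proof.
move=> /is_submodule_R hN; have [/is_submodule_R hS _ _] := stable_memberP.
have eta_prime Z eta : irreducible_component (Defs.support iota S) Z ->
    generic_point Z eta -> is_prime eta.
  by move=> [ZS _ _] [/ZS[]].
split=> h Z eta hZ heta; have pr := eta_prime _ _ hZ heta.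
  by have E := h Z eta hZ heta; split; apply/localize_subset => //; rewrite E.
have [h1 h2] := h Z eta hZ heta.
by apply/seteqP; split; apply/localize_subset.
Qed.

(** A single [u] outside [eta] carries [S] into [N]. Writing elements of [S] as elements of C_+ S
    retains [u] and halves the excess of the gauge over [d], until it vanishes. *)
Lemma core_generically_stable N : is_submodule D N ->
  generically_stable iota D N -> generically_stable iota D (core N d).
Proof.
move=> hN /(generically_stableP hN) stN.
have hNR := is_submodule_R hN; have [N0 ND NZ] := hNR.
have coreN : core N d `<=` N by apply: core_subset => // x [].
have [hS S_plus S_core] := stable_memberP.
apply/generically_stableP; first exact: core_submodule.
move=> Z eta hZ heta; have [SN NS] := stN Z eta hZ heta.
split; last by move=> x /coreN; exact: NS.
have [_ eta1 eta_pr] : is_prime eta.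
  by case: hZ => ZS _ _; case: heta => /ZS[].
have [q [v [vS vgen]]] := gauge_subspace_fg
  (@k_subspace_gauge _ d (is_submodule_R hS)) (fun x h => h.2).
have /choice[w hw] : forall i, exists w, ~ eta w /\ N (rscale iota w (v i)).
  by move=> i; have [w ? ?] := SN _ (vS i).1; exists w.
(* [u] is a common denominator for the finite spanning family [v]; it avoids [eta] because [eta] is
   prime. *)
pose u := \prod_i w i.
have etau : ~ eta u.
  rewrite /u; elim/big_ind: _ => // [x y nx ny /eta_pr[]//|i _].
  exact: (hw i).1.
have Nuv i : N (rscale iota u (v i)).
  by rewrite /u (bigD1 i)//= mulrC -rscaleA; apply/NZ; exact: (hw i).2.
have [h uE] : exists h, pi h = u.
  have : range pi u by rewrite hpi.
  by case=> h _ <-; exists h.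
(* Multiplication by [u = pi h] raises the gauge by at most the bound on the exponents of [h]. *)
have start x : S x -> core N (d + mmeasure mdeg h) (rscale iota u x).
  move=> /S_core; apply: add_closure_map; [exact: rscaler0|exact: rscaleDr|].
  move=> _ [r [y [Sy Gy ->]]]; have [a ->] := vgen y (conj Sy Gy).
  rewrite rscaleA rscale_sumr; apply: add_closure_sum => i _.
  apply: add_closure_gen; rewrite rscaleA.
  exists (r * pi (mpolyC n (a i))), (rscale iota u (v i)); split => //.
    rewrite -uE; apply: gauge_filtrationZ; last exact: (vS i).2.
    exact: bounded_monomials_msize.
  by rewrite [RHS]rscaleA; congr rscale; ring.
suff descent b : (forall x, S x -> core N b (rscale iota u x)) ->
    forall x, S x -> core N d (rscale iota u x).
  by move=> x Sx; exists u => //; apply: descent start _ Sx.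
elim/ltn_ind: b => b IH hb.
have [bd|db] := leqP b d.
  by move=> x /hb; exact: coreS.
(* For [b] above 2 [kappa], [b./2 + kappa] is smaller than [b]. *)
apply: (IH (b./2 + kappa)%N); first by rewrite addnn in db; lia.
move=> x /S_plus; apply: add_closure_map; [exact: rscaler0|exact: rscaleDr|].
move=> _ [e [c [y [e0 Dc Sy ->]]]].
rewrite /rscale scalerA (piece_frobenius hD _ Dc).
(* One factor [u] stays with [y], where the bound [b] is known; the others are absorbed by [c]. *)
have -> : u ^+ (p ^ e) = u ^+ (p ^ e).-1 * u.
  by rewrite -exprSr prednK// expn_gt0 prime_gt0.
rewrite rmorphM mulrA -scalerA.
apply: (core_contracts e0 _ (piece_mulr _ Dc) (hb y Sy)).
by have /is_submoduleP[_ _ NM] := hN; exact: NM.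
Qed.

Lemma generically_stableI N N' : is_submodule D N -> is_submodule D N' ->
  generically_stable iota D N -> generically_stable iota D N' ->
  is_submodule D (N `&` N') /\ generically_stable iota D (N `&` N').
Proof.
move=> hN hN' st st'.
have hI : is_submodule D (N `&` N').
  have [N0 ND NM] := hN; have [N0' ND' NM'] := hN'.
  by split=> [|x y [? ?] [? ?]|c x Dc [? ?]]; split;
    by [|exact: ND|exact: ND'|exact: NM|exact: NM'].
split => //; apply/generically_stableP => // Z eta hZ heta.
move/(generically_stableP hN): st => st.
move/(generically_stableP hN'): st' => st'.
have [SN NS] := st Z eta hZ heta; have [SN' _] := st' Z eta hZ heta.
have [_ _ eta_pr] : is_prime eta.
  by case: hZ => ZS _ _; case: heta => /ZS[].
split; last by move=> x [/NS].
move=> x Sx; have [w etaw Nw] := SN x Sx; have [w' etaw' Nw'] := SN' x Sx.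
exists (w * w'); first by move=> /eta_pr[].
have [_ _ NZ] := is_submodule_R hN; have [_ _ NZ'] := is_submodule_R hN'.
split; last by rewrite -rscaleA; exact: NZ'.
by rewrite mulrC -rscaleA; exact: NZ.
Qed.

(** Take [N0] in the class whose part in [G d] has least dimension. Intersecting with another member
    cannot shrink this part, so [core N0 d] lies in every member; being a member itself, it is the
    test module. *)
Lemma test_module_core : R_submodule (test_module iota (M := M) D) /\
  test_module iota (M := M) D `<=` core (test_module iota (M := M) D) d.
Proof.
have [q [dm [_ dmlt]]] := gauge_subspace_dim iota pi g d.
pose in_class N := is_submodule D N /\ generically_stable iota D N.
have ex : exists v, `[< exists2 N, in_class N & v = dm (N `&` G d) >].
  have [hS _ _] := stable_memberP.
  by exists (dm (S `&` G d)); apply/asboolP; exists S.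
case: (ex_minnP ex) => v /asboolP[N0 [hN0 st0] ->] vmin.
have N0_min N : in_class N -> N0 `&` G d `<=` N.
  move=> [hN st]; apply: contrapT => nN.
  have [hI stI] := generically_stableI hN0 hN st0 st.
  suff: (dm (N0 `&` N `&` G d) < dm (N0 `&` G d))%N.
    by rewrite ltnNge vmin//; apply/asboolP; exists (N0 `&` N).
  apply: dmlt; [exact/k_subspace_gauge/is_submodule_R| |by move=> x []|].
    exact/k_subspace_gauge/is_submodule_R.
  split; first by move=> x [[]].
  by move=> sub; apply: nN => x /sub[[]].
have coreN0 : in_class (core N0 d).
  by split; [exact: core_submodule|exact: core_generically_stable].
have -> : test_module iota (M := M) D = core N0 d.
  apply/seteqP; split; first by apply: smallest_sub.
  move=> x hx N [hN _]; move: x hx; apply: core_subset; last exact: N0_min.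
  exact/is_submodule_R/hN.1.
split; first exact: core_R_submodule.
apply: core_subset; first exact: core_R_submodule.
by move=> x [Nx Gx]; apply: core_gen => //; exact: core_gen.
Qed.

End TestModules.

(** * Separation of the jumping numbers by dimension *)

Theorem corollary4p19 (RR : realType) (p : nat) (k : fieldType)
    (hp : p \in [pchar k]) (hk : Ffinite p k)
    (n : nat) (R : comPzRingType) (pi : {rmorphism mpoly n k -> R})
    (hpi : range pi = setT)
    (C : pzRingType) (iota : {rmorphism R -> C}) (D : nat -> set C)
    (hC : cartier_algebra p iota D)
    (M : lmodType C) (hM : coherent iota M)
    (hgauge : gauge_bounded p iota M pi RR D)
    (a : set R) (ha : is_ideal a) :
  limit_point [set t : RR | jumping_number p iota M D a t] = set0.
Proof.
have [hD _] := hC; have p_prime := pcharf_prime hp.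
have [l [g [delta [hg hdelta [J [ev [psi [K [hpsi psi_gen hK]]]]]]]]] := hgauge.
apply/seteqP; split => // t0 /limit_point_infinite_setP.
(* This half-line is a neighbourhood of [t0]; it remains to see that it contains only finitely many
   jumping numbers. *)
have U0 : nbhs t0 [set t | t < t0 + 1].
  by apply: open_nbhs_nbhs; split; [exact: open_lt|rewrite /= ltrDl].
move=> /(_ _ U0); apply.
(* [T] is a natural number above [t0 + 1], so one [kappa] serves all parameters involved. *)
pose T := Num.bound (`|t0| + 1).
have t0T : t0 + 1 <= T%:R.
  rewrite (@le_trans _ _ (`|t0| + 1)) ?lerD2r ?ler_norm//.
  by rewrite ltW// archi_boundP// addr_ge0.
have [kappa hcontr] := twist_contracting p_prime hpi hD ha hdelta T psi_gen
  (fun i => (hpsi i).2) hK.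
pose tau (t : RR) := test_module iota (M := M) (twist p iota D a t).
have tauP (t : RR) : 0 <= t <= T%:R -> R_submodule iota (tau t) /\
    tau t `<=` core iota pi g (tau t) (kappa + kappa).
  move=> tT; have /andP[t_ge0 _] := tT.
  have hDt := twist_cartier (prime_gt0 p_prime) t_ge0 ha hD.
  exact (test_module_core p_prime hDt hpi hg (hcontr t tT)).
have [q [dm [dmq dmlt]]] :=
  gauge_subspace_dim iota pi g (kappa + kappa).
pose V (t : RR) := tau t `&` gauge_filtration iota pi g (Some (kappa + kappa)%N).
(* The jump condition with [eps = t - s] makes [tau t] a proper part of [tau s]. As [tau s] is
   generated by [V s], already [V t] is proper in [V s]. *)
have Vlt s t : 0 < s -> s < t -> t < t0 + 1 ->
    jumping_number p iota M D a t -> (dm (V t) < dm (V s))%N.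
  move=> s0 st tt0 [t_gt0 jt].
  have tT : t <= T%:R by rewrite (le_trans (ltW tt0)).
  have [|tauV _] := tauP t; first by rewrite (ltW t_gt0).
  have [|sauV s_core] := tauP s.
    by rewrite (ltW s0) (le_trans (ltW st)).
  have [|sub nsub] := jt (t - s); first by rewrite subr_gt0 st lerBlDr lerDl ltW.
  rewrite subKr in sub nsub.
  apply: dmlt; [exact: k_subspace_gauge|exact: k_subspace_gauge|by move=> x []|].
  split; first by move=> x [/sub].
  move=> VV; apply: nsub; apply: (subset_trans s_core).
  by apply: core_subset => // x /VV[].
have V_inj : {in [set t | t < t0 + 1] `&` [set t : RR |
    jumping_number p iota M D a t] &, injective (dm \o V)}.
  move=> s t; rewrite !inE => -[st0 js] [tt0 jt] /= E.
  case: (ltgtP s t) => // st.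
    by have := Vlt s t js.1 st tt0 jt; rewrite E ltnn.
  by have := Vlt t s jt.1 st st0 js; rewrite E ltnn.
(* The jumping numbers in the half-line inject into the integers from 0 to [q]. *)
rewrite -(eq_finite_set (inj_card_eq V_inj)).
apply: sub_finite_set (finite_II q.+1) => _ [t _ <-] /=.
by rewrite ltnS.
Qed.
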